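(* For any lattice $\mathcal{L} \subset \mathbb{R}^n$ and vector $\mathbf{x} \in \mathbb{R}^n$, we have the positive semidefinite inequality \[ \mathbb{E}_{\mathbf{w} \sim D_{\mathcal{L} + \mathbf{x}}}[\mathbf{w}\mathbf{w}^T] - \mathbb{E}_{\mathbf{w} \sim D_{\mathcal{L} + \mathbf{x}}}[\mathbf{w}]\;\mathbb{E}_{\mathbf{w} \sim D_{\mathcal{L} + \mathbf{x}}}[\mathbf{w}^T] \succeq \mathbb{E}_{\mathbf{w} \sim D_{\mathcal{L}}}[\mathbf{w}\mathbf{w}^T] . \] In particular, \[ \mathbb{E}_{\mathbf{w} \sim D_{\mathcal{L} + \mathbf{x}}}[\|\mathbf{w}\|^2] - \Big\|\mathbb{E}_{\mathbf{w} \sim D_{\mathcal{L} + \mathbf{x}}}[\mathbf{w}]\Big\|^2 \geq \mathbb{E}_{\mathbf{w} \sim D_{\mathcal{L}}}[\|\mathbf{w}\|^2] . \]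
   Context: A lattice $\mathcal{L}\subset\mathbb{R}^n$ is the set of all integer linear combinations of $n$ linearly independent vectors of $\mathbb{R}^n$. For $\mathbf{x}\in\mathbb{R}^n$, $\rho(\mathbf{x}) = \exp(-\pi \|\mathbf{x}\|^2)$ with $\|\cdot\|$ the Euclidean norm, and for a discrete set $A\subset\mathbb{R}^n$, $\rho(A) = \sum_{\mathbf{w}\in A}\rho(\mathbf{w})$. The discrete Gaussian distribution $D_{\mathcal{L}+\mathbf{x}}$ is the probability distribution on the coset $\mathcal{L}+\mathbf{x}$ assigning probability $\rho(\mathbf{w})/\rho(\mathcal{L}+\mathbf{x})$ to each $\mathbf{w}\in\mathcal{L}+\mathbf{x}$; $D_{\mathcal{L}}$ is the case $\mathbf{x}=\mathbf{0}$. For symmetric matrices, $A\succeq B$ means that $A-B$ is positive semidefinite. Vectors are column vectors. *)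

(* Defs.v *)
From HB Require Import structures.
From mathcomp Require Import all_boot all_order all_algebra.
From mathcomp Require Import all_classical all_reals all_analysis.

Set Implicit Arguments.
Unset Strict Implicit.
Unset Printing Implicit Defensive.

Import Order.TTheory GRing.Theory Num.Theory.
Import numFieldNormedType.Exports.

Local Open Scope classical_set_scope.
Local Open Scope ring_scope.

Definition is_lattice (R : realType) (n : nat) (L : set 'cV[R]_n) : Prop :=
  exists b : n.-tuple 'cV[R]_n,
    free b /\ L = [set \sum_(i < n) tnth b i *~ z i | z in [set: 'I_n -> int]].

Definition coset (R : realType) (n : nat) (L : set 'cV[R]_n) (x : 'cV[R]_n) :
  set 'cV[R]_n := [set v + x | v in L].

(* The norm [`|x|] of the library on matrices is the sup norm. *)
Definition l2norm (R : realType) (n : nat) (x : 'cV[R]_n) : R :=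
  Num.sqrt (\sum_(i < n) x i 0 ^+ 2).

Definition rho (R : realType) (n : nat) (x : 'cV[R]_n) : R :=
  expR (- (pi * l2norm x ^+ 2)).

Definition rho_set (R : realType) (n : nat) (A : set 'cV[R]_n) : \bar R :=
  (\esum_(w in A) (rho w)%:E)%E.

(* R^n with the power set as sigma-algebra: the laws considered below are
   carried by countable sets, so that every function is a random variable. *)
Definition discrete_cV (R : realType) (n : nat) : measurableType _ :=
  g_sigma_algebraType [set: set 'cV[R]_n].

Section gaussian_mass.
Context (R : realType) (n : nat) (A : set 'cV[R]_n).
Local Open Scope ereal_scope.

Definition gaussian_mass (U : set (discrete_cV R n)) : \bar R :=
  rho_set (A `&` U).

Let gaussian_mass0 : gaussian_mass set0 = 0.
Proof. by rewrite /gaussian_mass setI0 /rho_set esum_set0. Qed.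

Let gaussian_mass_ge0 U : 0 <= gaussian_mass U.
Proof. by apply: esum_ge0 => w _; rewrite lee_fin expR_ge0. Qed.

Let gaussian_mass_sigma_additive : semi_sigma_additive gaussian_mass.
Proof.
move=> F _ tF _; rewrite /gaussian_mass /rho_set setI_bigcupr.
rewrite nneseries_sum_bigcup.
- by apply: is_cvg_nneseries => k _ _; exact: gaussian_mass_ge0.
- exact: trivIset_setIl.
- by move=> w; rewrite lee_fin expR_ge0.
Qed.

HB.instance Definition _ := isMeasure.Build _ _ _ gaussian_mass
  gaussian_mass0 gaussian_mass_ge0 gaussian_mass_sigma_additive.

End gaussian_mass.

(* [mnormalize] divides by rho_set A, which lies in ]0, +oo[ when A is a coset
   of a lattice; the Dirac mass is only its default value for a total mass
   equal to 0 or +oo. *)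
Definition discrete_gaussian (R : realType) (n : nat) (A : set 'cV[R]_n) :
    probability (discrete_cV R n) R :=
  mnormalize (gaussian_mass A) (@dirac _ (discrete_cV R n) (0 : 'cV[R]_n) R).

(* Entrywise expectation; [fine] is harmless for integrable entries, as are all
   polynomials in w under a discrete Gaussian on a lattice coset. *)
Definition mx_expectation (d : measure_display) (T : measurableType d)
    (R : realType) (P : probability T R) (m p : nat) (X : T -> 'M[R]_(m, p)) :
  'M[R]_(m, p) := \matrix_(i, j) fine 'E_P[fun w => X w i j].

Definition psdmx (R : realType) (n : nat) (A : 'M[R]_n) : Prop :=
  A \is symmetricmx /\ forall v : 'cV[R]_n, 0 <= (v^T *m A *m v) 0 0.

Definition psd_ge (R : realType) (n : nat) (A B : 'M[R]_n) : Prop :=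
  psdmx (A - B).

(* Main.v *)
(* For a in L + x and b in L put p = a + b and q = a - b; then (p, q) runs over
   the pairs of points of L + x that are congruent mod 2L, and
   rho a * rho b = e p * e q with e w = exp (- pi |w|^2 / 2).  For a vector u, a
   real t and s w = <w, u> - t,
     (<a, u> - t)^2 - <b, u>^2 = s p * s q,
   so summing against rho a * rho b gives a sum over the classes c mod 2L of
   (sum_(p in c) s p * e p)^2, which is nonnegative.  Hence
   E_(L + x) [(<w, u> - t)^2] >= E_L [<w, u>^2] for every t, and t is taken to
   be E_(L + x) [<w, u>]. *)

Require Import Defs.
From mathcomp Require Import all_boot all_order all_algebra.
From mathcomp Require Import all_classical all_reals all_analysis.
From mathcomp Require Import ring lra zify.

Set Implicit Arguments.
Unset Strict Implicit.
Unset Printing Implicit Defensive.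

Import Order.TTheory GRing.Theory Num.Theory.
Import numFieldNormedType.Exports.

Local Open Scope classical_set_scope.
Local Open Scope ring_scope.

(** * Sums over pairs of points in the same class *)

Lemma esumZl (R : realType) (T : choiceType) (D : set T) (k : R)
    (f : T -> \bar R) : 0 <= k -> (forall i, 0 <= f i)%E ->
  (\esum_(i in D) (k%:E * f i) = k%:E * \esum_(i in D) f i)%E.
Proof.
move=> k0 f0; rewrite /esum -ereal_supZl//; last first.
  by apply/set0P; exists 0%E, set0; [exact: fsets_set0|rewrite fsbig_set0].
congr ereal_sup; apply/seteqP; split => y /=.
  move=> [A DA <-]; exists (\sum_(i \in A) f i)%E; first by exists A.
  by rewrite ge0_mule_fsumr.
by move=> [_ [A DA <-] <-]; exists A => //; rewrite ge0_mule_fsumr.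
Qed.

(** Grouping by the class [k] gives, for each [k], the square of the sum of [f] over that class. *)
Lemma sum_same_class_ge0 (R : realDomainType) (T : Type) (C : finType)
    (c : T -> C) (s : seq T) (f : T -> R) :
  0 <= \sum_(p <- s) \sum_(q <- s | c q == c p) f p * f q.
Proof.
rewrite (partition_big c xpredT)//=; apply: sumr_ge0 => k _.
have -> : \sum_(p <- s | c p == k) \sum_(q <- s | c q == c p) f p * f q =
    (\sum_(p <- s | c p == k) f p) ^+ 2.
  rewrite expr2 mulr_suml; apply: eq_bigr => p /eqP ->.
  by rewrite mulr_sumr.
exact: sqr_ge0.
Qed.

(* This is [\sum f p * f q * g p * g q >= 0], polarised so that only sums of
   nonnegative terms occur. *)
Lemma esum_same_class_le (R : realType) (T : choiceType) (C : finType)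
    (c : T -> C) (f g : T -> R) : (forall p, 0 <= g p) ->
  (\esum_(h in [set h : T * T | c h.1 = c h.2])
      ((f h.1 - f h.2) ^+ 2 * (g h.1 * g h.2))%:E <=
   \esum_(h in [set h : T * T | c h.1 = c h.2])
      ((f h.1 + f h.2) ^+ 2 * (g h.1 * g h.2))%:E)%E.
Proof.
move=> g0; apply: ub_ereal_sup => _ [_ [/finite_seqP[t ->] tD] <-].
(* A finite set [t] of pairs need not be made of full class blocks. It is enlarged to [H], all
   same-class pairs of components occurring in [t]; the terms are nonnegative, so the left sum only
   grows. *)
pose s := undup ([seq h.1 | h <- t] ++ [seq h.2 | h <- t]).
pose H : seq (T * T) := [seq (p, q) | p <- s, q <- [seq q <- s | c q == c p]].
have uH : uniq H.
  apply: allpairs_uniq_dep; first exact: undup_uniq.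
    by move=> p _; rewrite filter_uniq// undup_uniq.
  by move=> [a b] [a' b'] _ _ /= [-> ->].
have tH : [set` t] `<=` [set` H].
  move=> [p q] tpq /=; apply/allpairsPdep; exists p, q.
  split => //.
    by rewrite mem_undup mem_cat; apply/orP; left; apply/mapP; exists (p, q).
  rewrite mem_filter (tD _ tpq)/= eqxx mem_undup mem_cat; apply/orP; right.
  by apply/mapP; exists (p, q).
have HD : [set` H] `<=` [set h : T * T | c h.1 = c h.2].
  move=> _ /= /allpairsPdep[p [q [_ qs ->]]]/=.
  move: qs; rewrite mem_filter => /andP[/eqP e _]. by rewrite e.
apply: esum_ge; exists [set` H]; first by split => //; exact: finite_seq.
apply: (@le_trans _ _
  (\sum_(h \in [set` H]) ((f h.1 - f h.2) ^+ 2 * (g h.1 * g h.2))%:E)%E).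
  apply: lee_fsum_nneg_subset => //; try exact: finite_seq.
    by move=> h /set_mem/tH/mem_set.
  by move=> h _; rewrite lee_fin mulr_ge0 ?sqr_ge0 ?mulr_ge0.
rewrite -!fsbig_seq// !sumEFin lee_fin -subr_ge0 -sumrB.
rewrite /H big_allpairs_dep.
under eq_bigr do rewrite big_filter.
(* The summands differ by [4 * f p * f q * g p * g q], the product of the values of [2 * f * g] at
   [p] and [q]. *)
have := sum_same_class_ge0 c s (fun p => 2 * f p * g p).
congr (_ <= _); apply: eq_bigr => p _; apply: eq_bigr => q _ /=; ring.
Qed.

(** * Sum and difference of integer vectors, and classes mod 2 *)

Section parity.
Variable n : nat.
Implicit Type z : {ffun 'I_n -> int}.

(** The class of [z] mod 2, with [true] for even entries. Boolean values make the classes a finite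
    type, as [sum_same_class_ge0] requires. *)
Definition parity z : {ffun 'I_n -> bool} := [ffun i => (z i %% 2)%Z == 0].

(** The entries of [y + z] and [y - z] differ by even numbers. Conversely, if [p] and [q] have equal
    parity, the halves of [p + q] and [p - q] are exact and give the preimage. *)
Lemma sumdiff_bij :
  set_bij [set: {ffun 'I_n -> int} * {ffun 'I_n -> int}]
    [set h : {ffun 'I_n -> int} * {ffun 'I_n -> int} | parity h.1 = parity h.2]
    (fun h => (h.1 + h.2, h.1 - h.2)).
Proof.
have eqL (a b c d : int) : a + b = c + d -> a - b = c - d -> a = c by lia.
have eqR (a b c d : int) : a + b = c + d -> a - b = c - d -> b = d by lia.
have par (a b : int) : ((a + b) %% 2)%Z = ((a - b) %% 2)%Z by lia.
have halfD (a b : int) : ((a %% 2)%Z == 0) = ((b %% 2)%Z == 0) ->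
  ((a + b) %/ 2)%Z + ((a - b) %/ 2)%Z = a by lia.
have halfB (a b : int) : ((a %% 2)%Z == 0) = ((b %% 2)%Z == 0) ->
  ((a + b) %/ 2)%Z - ((a - b) %/ 2)%Z = b by lia.
split.
- by move=> [y z] _ /=; apply/ffunP => i; rewrite !ffunE par.
- move=> [y z] [y' z'] _ _ /= [/ffunP e1 /ffunP e2].
  by congr pair; apply/ffunP => i; move: (e1 i) (e2 i); rewrite !ffunE;
    [exact: eqL | exact: eqR].
- move=> [p q] /= /ffunP pq.
  exists ([ffun i => ((p i + q i) %/ 2)%Z],
          [ffun i => ((p i - q i) %/ 2)%Z]) => //=.
  by congr pair; apply/ffunP => i; move: (pq i); rewrite !ffunE;
    [exact: halfD | exact: halfB].
Qed.

End parity.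

(** * Summability of geometric weights over integer vectors *)

Section summability.
Variables (R : realType) (n : nat).

(** [Posz k] has absolute value [k] and [Negz k] has [k + 1], so each sign contributes at most the
    geometric series [1 / (1 - r)]. *)
Lemma geometric_int_sum (r : R) (N : nat) : 0 <= r < 1 ->
  \sum_(j : bool * 'I_N) r ^+ `|if j.1 then Posz j.2 else Negz j.2|%N
    <= 2 / (1 - r).
Proof.
move=> /andP[r0 r1].
have geo : \sum_(k < N) r ^+ k <= (1 - r)^-1.
  rewrite -[leRHS]mul1r ler_pdivlMr ?subr_gt0// mulrC.
  by rewrite -opprB mulNr -subrX1 opprB gerBl exprn_ge0.
rewrite -(pair_bigA _ (fun b (k : 'I_N) =>
  r ^+ `|if b then Posz k else Negz k|%N))/= big_bool/=.
rewrite mulrDl mul1r lerD//.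
apply: le_trans geo; apply: ler_sum => k _.
by rewrite exprS ler_piMl ?exprn_ge0// ltW.
Qed.

(** A finite set of integer vectors lies in a box with sides from [-N] to [N - 1]. Over the box the
    sum factors into the [n]-th power of a one-dimensional sum, whose bound is independent of
    [N]. *)
Lemma esum_geometric_ffun_lty (r : R) : 0 <= r < 1 ->
  (\esum_(z in [set: {ffun 'I_n -> int}]) (\prod_i r ^+ `|z i|%N)%:E < +oo)%E.
Proof.
move=> r01; have /andP[r0 r1] := r01.
apply: (@le_lt_trans _ _ ((2 / (1 - r)) ^+ n)%:E); last by rewrite ltry.
apply: ub_ereal_sup => _ [_ [/finite_seqP[t ->] _] <-].
pose N := (\max_(z <- t) \max_i `|z i|%N).+1.
pose J : finType := (bool * 'I_N)%type.
pose psi (j : J) := if j.1 then Posz j.2 else Negz j.2.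
pose B : seq {ffun 'I_n -> int} :=
  [seq [ffun i => psi (f i)] | f : {ffun 'I_n -> J}].
have psi_inj : injective psi.
  move=> [[] k] [[] l]; rewrite /psi/= => kl;
    by [] || by injection kl => /ord_inj ->.
have uB : uniq B.
  rewrite map_inj_uniq ?enum_uniq// => f g /ffunP fg; apply/ffunP => i.
  by have := fg i; rewrite !ffunE => /psi_inj.
have tB : [set` t] `<=` [set` B].
  move=> z tz /=.
  have zN i : (`|z i| < N)%N.
    rewrite ltnS; apply: leq_trans (leq_bigmax (F := fun j => `|z j|%N) i) _.
    exact: (leq_bigmax_seq (F := fun z : {ffun _} => \max_i `|z i|%N)).
  (* The inverse of [psi] on the box. For [Negz k] the index is [k], one less than the absolute
     value, hence still below [N]. *)
  pose h i : J := (if z i is Posz _ then true else false,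
     inord (if z i is Negz k then k else `|z i|%N)).
  apply/mapP; exists [ffun i => h i]; first by rewrite mem_enum.
  apply/ffunP => i; rewrite !ffunE /psi /h/=; move: (zN i).
  by case: (z i) => k /= kN; rewrite inordK//; apply: ltn_trans kN.
apply: (@le_trans _ _ (\sum_(z \in [set` B]) (\prod_i r ^+ `|z i|%N)%:E)%E).
  apply: lee_fsum_nneg_subset => //; try exact: finite_seq.
  - by move=> h /set_mem/tB/mem_set.
  - by move=> z _; rewrite lee_fin prodr_ge0// => i _; rewrite exprn_ge0.
rewrite -fsbig_seq// sumEFin lee_fin /B big_map big_enum/=.
under eq_bigr do under eq_bigr do rewrite ffunE.
(* Distributivity: a sum over functions of products is a product of sums. *)
rewrite -(bigA_distr_bigA (fun (_ : 'I_n) (j : J) => r ^+ `|psi j|%N)).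
rewrite prodr_const card_ord lerXn2r ?nnegrE//.
- by apply: sumr_ge0 => j _; rewrite exprn_ge0.
- by rewrite divr_ge0 ?subr_ge0 ?ltW.
- exact: (geometric_int_sum N r01).
Qed.

End summability.

(** * Integration on a countable set of vectors *)

Section discrete_integral.
Variables (R : realType) (n : nat).

Lemma measurable_discrete_cV (U : set (discrete_cV R n)) : measurable U.
Proof. exact: sub_sigma_algebra. Qed.

Lemma measurable_fun_discrete_cV d (S : sigmaRingType d)
  (D : set (discrete_cV R n)) (f : discrete_cV R n -> S) : measurable_fun D f.
Proof. by move=> _ Y _; exact: measurable_discrete_cV. Qed.

Lemma integral_set1_discrete_cV (mu : {measure set (discrete_cV R n) -> \bar R})
    (w : 'cV[R]_n) (f : 'cV[R]_n -> \bar R) :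
  (\int[mu]_(v in [set w]) f v = f w * mu [set w])%E.
Proof.
rewrite (eq_integral (cst (f w))); last by move=> v /set_mem ->.
by rewrite integral_cst//; exact: measurable_discrete_cV.
Qed.

(** The range of [phi] carries the measure and is a countable disjoint union of points, so the
    integral splits into integrals over singletons. *)
Lemma integral_discrete_cV (mu : {measure set (discrete_cV R n) -> \bar R})
    (I : countType) (phi : I -> 'cV[R]_n) (f : 'cV[R]_n -> \bar R) :
  injective phi -> mu (~` range phi) = 0%E -> (forall w, 0 <= f w)%E ->
  (\int[mu]_w f w = \esum_(i in [set: I]) (f (phi i) * mu [set phi i]))%E.
Proof.
move=> phi_inj mu0 f0.
(* Sorting [I] by [pickle] gives a sequence of sets with at most one element each, the form that
   countable additivity over [nat] takes. *)
pose E k := [set i : I | pickle i = k].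
have EE i : E (pickle i) = [set i].
  by apply/seteqP; split=> j /= => [/(pcan_inj pickleK)|->].
have E0 k : E k = set0 \/ exists i, E k = [set i].
  have [->|/set0P[i Ei]] := eqVneq (E k) set0; [by left|right].
  by exists i; rewrite -Ei EE.
have bE : [set: I] = \bigcup_k E k.
  by apply/seteqP; split=> // i _; exists (pickle i).
have tE : trivIset [set: nat] E by move=> k l _ _ [i [/= <- <-]].
rewrite (@ge0_negligible_integral _ (discrete_cV R n) _ mu setT (~` range phi))//;
  [|exact: measurable_discrete_cV|exact: measurable_fun_discrete_cV].
rewrite setTD setCK bE image_bigcup ge0_integral_bigcup//; last 3 first.
- by move=> k; exact: measurable_discrete_cV.
- exact: measurable_fun_discrete_cV.
- move=> k l _ _ [_ [[i Ei <-] [j Ej /phi_inj ij]]].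
  by apply: tE => //; exists i; split => //; rewrite -ij.
rewrite nneseries_sum_bigcup//; last by move=> i; rewrite mule_ge0.
apply: eq_eseriesr => k _; have [->|[i ->]] := E0 k.
  by rewrite image_set0 integral_set0 esum_set0.
by rewrite image_set1 integral_set1_discrete_cV esum_set1// mule_ge0.
Qed.

End discrete_integral.

Section discrete_gaussian_integral.
Variables (R : realType) (n : nat) (I : countType) (phi : I -> 'cV[R]_n).
Hypothesis phi_inj : injective phi.
Hypothesis phi_lty : (rho_set (range phi) < +oo)%E.
Let A := range phi.
Let r : R := fine (rho_set A).

Lemma rho_gt0 (w : 'cV[R]_n) : 0 < rho w.
Proof. exact: expR_gt0. Qed.

Lemma rho_set_fin_num : rho_set A = r%:E.
Proof.
rewrite fineK// ge0_fin_numE//; apply: esum_ge0 => w _.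
by rewrite lee_fin ltW ?rho_gt0.
Qed.

Lemma rho_set1 (w : 'cV[R]_n) : rho_set [set w] = (rho w)%:E.
Proof. by rewrite /rho_set esum_set1// lee_fin ltW ?rho_gt0. Qed.

Lemma rho_set_gt0 (i0 : I) : 0 < r.
Proof.
rewrite -lte_fin -rho_set_fin_num.
apply: (@lt_le_trans _ _ (rho (phi i0))%:E); first by rewrite lte_fin rho_gt0.
apply: esum_ge; exists [set phi i0]; last by rewrite fsbig_set1.
by split; [exact: finite_set1|move=> _ ->; exists i0].
Qed.

(** The point [i0] makes the total mass positive and [phi_lty] makes it finite, so [mnormalize]
    divides and does not fall back on the Dirac mass. *)
Lemma discrete_gaussianE (i0 : I) U :
  discrete_gaussian A U = (rho_set (A `&` U) * (r^-1)%:E)%E.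
Proof.
have r0 := rho_set_gt0 i0.
rewrite /discrete_gaussian /= /mnormalize /= /gaussian_mass setIT.
by rewrite rho_set_fin_num eqe (gt_eqF r0).
Qed.

Lemma integral_discrete_gaussian (i0 : I) (f : 'cV[R]_n -> \bar R) :
  (forall w, 0 <= f w)%E ->
  (\int[discrete_gaussian A]_w f w =
   \esum_(i in [set: I]) (f (phi i) * (rho (phi i) / r)%:E))%E.
Proof.
move=> f0; rewrite (@integral_discrete_cV _ _ _ I phi)//; last first.
  apply: (etrans (discrete_gaussianE i0 _)).
  by rewrite setICr /rho_set esum_set0 mul0e.
apply: eq_esum => i _; congr (_ * _)%E.
apply: (etrans (discrete_gaussianE i0 _)).
have -> : A `&` [set phi i] = [set phi i].
  by apply/seteqP; split=> [w []//|_ ->]; split => //; exists i.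
by rewrite rho_set1 -EFinM.
Qed.

End discrete_gaussian_integral.

Section esum_pair.
Variables (R : realType) (T1 T2 : choiceType) (f : T1 -> R) (p : T2 -> R).
Hypotheses (f0 : forall y, 0 <= f y) (p0 : forall z, 0 <= p z).
Hypothesis p1 : (\esum_(z in [set: T2]) (p z)%:E = 1)%E.

(** Tonelli with a factor of total mass 1. It serves to bring sums over two different cosets to one
    common index set of pairs. *)
Lemma esum_pairl :
  (\esum_(h in [set: T1 * T2]) (f h.1 * p h.2)%:E =
   \esum_(y in [set: T1]) (f y)%:E)%E.
Proof.
have -> : [set: T1 * T2] = setT `*`` (fun=> setT) by apply/seteqP; split.
rewrite -(esum_esum (a := fun y z => (f y * p z)%:E)).
  apply: eq_esum => y _; under eq_esum do rewrite EFinM.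
  by rewrite esumZl ?p1 ?mule1// => z; rewrite lee_fin.
by move=> y z _ _; rewrite lee_fin mulr_ge0.
Qed.

Lemma esum_pairr :
  (\esum_(h in [set: T2 * T1]) (f h.2 * p h.1)%:E =
   \esum_(y in [set: T1]) (f y)%:E)%E.
Proof.
rewrite -esum_pairl.
rewrite (@reindex_esum _ _ _ [set: T2 * T1] setT (fun h => (h.2, h.1)))//.
by split => // [[a b] [a' b'] _ _ [-> ->]|[a b] _] //; exists (b, a).
Qed.

End esum_pair.

(** * Tails of lattice Gaussians *)

Section gaussian_tail.
Variables (R : realType) (n : nat).
Implicit Types w x : 'cV[R]_n.

Lemma l2norm_sqr w : l2norm w ^+ 2 = \sum_i w i 0 ^+ 2.
Proof. by rewrite sqr_sqrtr// sumr_ge0// => i _; rewrite sqr_ge0. Qed.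

Lemma rhoE w : rho w = expR (- (pi * \sum_i w i 0 ^+ 2)).
Proof. by rewrite /rho l2norm_sqr. Qed.

(** Write [q] for the sum of squares and [s] for the sum of absolute values. From [1 + q <= expR q]
    and [pi >= 2] the left side is at most [expR (- q)], and [s <= n + q] coordinatewise. The linear
    exponent is what compares with products of geometric terms. *)
Lemma rho_tail w :
  (1 + \sum_i w i 0 ^+ 2) * rho w <= expR (n%:R - \sum_i `|w i 0|).
Proof.
rewrite rhoE; set q := \sum_i _ ^+ 2; set s := \sum_i `|_|.
have q0 : 0 <= q by apply: sumr_ge0 => i _; rewrite sqr_ge0.
have sq : s <= n%:R + q.
  rewrite /s /q -[n in n%:R]card_ord -sumr_const -big_split/=.
  by apply: ler_sum => i _; rewrite -real_normK ?num_real//; nra.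
apply: (@le_trans _ _ (expR q * expR (- (pi * q)))).
  by rewrite ler_wpM2r ?expR_ge0// expR_ge1Dx.
rewrite -expRD ler_expR.
have := @pi_ge2 R; nra.
Qed.

End gaussian_tail.

Section lattice.
Variables (R : realType) (n : nat) (b : n.-tuple 'cV[R]_n).
Implicit Types (z : {ffun 'I_n -> int}) (x : 'cV[R]_n).

(** Coordinates are taken as finite functions, a countable type with an addition, so that they can
    index the sums and integrals over the lattice. *)
Definition lattice_vec z : 'cV[R]_n := \sum_(i < n) tnth b i *~ z i.

Lemma lattice_vecD y z : lattice_vec (y + z) = lattice_vec y + lattice_vec z.
Proof.
rewrite -big_split/=; apply: eq_bigr => i _.
by rewrite ffunE mulrzDr.
Qed.

Lemma lattice_vecB y z : lattice_vec (y - z) = lattice_vec y - lattice_vec z.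
Proof.
rewrite -sumrB; apply: eq_bigr => i _.
by rewrite !ffunE mulrzBr.
Qed.

Lemma range_lattice_vec :
  range lattice_vec =
  [set \sum_(i < n) tnth b i *~ z i | z in [set: 'I_n -> int]].
Proof.
apply/seteqP; split=> _ [z _ <-].
  by exists (fun i => z i).
exists [ffun i => z i] => //; apply: eq_bigr => i _.
by rewrite ffunE.
Qed.

Lemma coset_lattice_vec x :
  coset (range lattice_vec) x = range (fun z => lattice_vec z + x).
Proof.
apply/seteqP; split=> [_ [_ [z _ <-] <-]|_ [z _ <-]]; first by exists z.
by exists (lattice_vec z) => //; exists z.
Qed.

Hypothesis free_b : free b.

Lemma coord_lattice_vec z j : coord b j (lattice_vec z) = (z j)%:~R.
Proof.
rewrite -(coord_sum_free (fun i => (z i)%:~R) j free_b); congr coord.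
by apply: eq_bigr => i _; rewrite (tnth_nth 0) scaler_int.
Qed.

Lemma lattice_vec_inj x : injective (fun z => lattice_vec z + x).
Proof.
move=> y z /addIr yz; apply/ffunP => i; apply: (@intr_inj R).
by rewrite -!coord_lattice_vec yz.
Qed.

(** Each integer coordinate is a linear functional of the vector, hence bounded by its values
    [K i j] on the standard basis. The added 1 makes the constant positive. *)
Lemma lattice_vec_coercive : exists2 C : R, 0 < C &
  forall z, \sum_i `|(z i)%:~R : R| <= C * \sum_i `|lattice_vec z i 0|.
Proof.
pose K i j : R := `|coord b j (delta_mx i 0)|.
exists (1 + \sum_j \sum_i K i j).
  rewrite ltr_wpDr//; apply: sumr_ge0 => j _; apply: sumr_ge0 => i _.
  exact: normr_ge0.
move=> z; rewrite mulrDl mul1r mulr_suml ler_wpDl ?sumr_ge0//.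
apply: ler_sum => j _; rewrite -coord_lattice_vec mulr_suml.
rewrite {1}(matrix_sum_delta (lattice_vec z)) linear_sum/=.
apply: le_trans (ler_norm_sum _ _ _) _.
apply: ler_sum => i _; rewrite big_ord1 linearZ/= normrM mulrC.
rewrite ler_wpM2l// (bigD1 i)//= lerDl sumr_ge0//.
Qed.

(** [rho_tail] leaves a linear exponent. The triangle inequality moves [x] into the constant [K],
    and coercivity bounds the rest by geometric terms of ratio [expR (- C^-1)]. *)
Lemma lattice_tail_lty x :
  (\esum_(z in [set: {ffun 'I_n -> int}])
     ((1 + \sum_i (lattice_vec z + x) i 0 ^+ 2) * rho (lattice_vec z + x))%:E
   < +oo)%E.
Proof.
have [C C0 zC] := lattice_vec_coercive.
pose r : R := expR (- C^-1).
have r01 : 0 <= r < 1 by rewrite expR_ge0/= -expR0 ltr_expR oppr_lt0 invr_gt0.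
pose K : R := expR (n%:R + \sum_i `|x i 0|).
apply: (@le_lt_trans _ _ (\esum_(z in [set: {ffun 'I_n -> int}])
    (K%:E * (\prod_i r ^+ `|z i|%N)%:E))%E); last first.
  rewrite esumZl ?expR_ge0//; last first.
    by move=> z; rewrite lee_fin prodr_ge0// => i _; rewrite exprn_ge0 ?expR_ge0.
  by rewrite lte_mul_pinfty ?lee_fin ?expR_ge0// esum_geometric_ffun_lty.
apply: le_esum => z _; rewrite -EFinM lee_fin (le_trans (rho_tail _))//.
have -> : \prod_i r ^+ `|z i|%N = expR (- (C^-1 * \sum_i `|(z i)%:~R : R|)).
  rewrite -mulNr mulr_sumr expR_sum; apply: eq_bigr => i _.
  by rewrite -expRM_natl mulrC -intr_norm natr_absz.
rewrite -expRD ler_expR -addrA lerD2l.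
have : C^-1 * \sum_i `|(z i)%:~R : R| <= \sum_i `|lattice_vec z i 0|.
  by rewrite ler_pdivrMl.
have : \sum_i `|lattice_vec z i 0| <=
    \sum_i `|(lattice_vec z + x) i 0| + \sum_i `|x i 0|.
  rewrite -big_split/=; apply: ler_sum => i _; rewrite mxE.
  by rewrite -{1}(addrK (x i 0) (lattice_vec z i 0)) ler_normB.
lra.
Qed.

End lattice.

(** * The variance inequality in a fixed direction *)

Section variance.
Variables (R : realType) (n : nat) (b : n.-tuple 'cV[R]_n).
Hypothesis free_b : free b.
Implicit Types (z : {ffun 'I_n -> int}) (x u : 'cV[R]_n).

Local Notation translate x := (fun z => lattice_vec b z + x).

Lemma rho_set_lattice_lty x : (rho_set (range (translate x)) < +oo)%E.
Proof.
rewrite /rho_set (@reindex_esum _ _ _ setT (range (translate x)) (translate x));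
  last first.
  split; [by move=> z _; exists z | | by []].
  by move=> y z _ _; exact: lattice_vec_inj.
apply: le_lt_trans (lattice_tail_lty free_b x); apply: le_esum => z _.
rewrite lee_fin ler_peMl ?expR_ge0// lerDl sumr_ge0// => i _.
exact: sqr_ge0.
Qed.

Lemma integral_lattice_gaussian x (f : 'cV[R]_n -> R) : (forall w, 0 <= f w) ->
  (\int[discrete_gaussian (range (translate x))]_w (f w)%:E =
   \esum_(z in [set: {ffun 'I_n -> int}])
     (f (lattice_vec b z + x) * (rho (lattice_vec b z + x)
       / fine (rho_set (range (translate x)))))%:E)%E.
Proof.
move=> f0; rewrite (integral_discrete_gaussian (@lattice_vec_inj _ _ _ free_b x)
  (rho_set_lattice_lty x) 0)//.
Qed.

Lemma esum_lattice_gaussian x :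
  (\esum_(z in [set: {ffun 'I_n -> int}])
     (rho (lattice_vec b z + x) / fine (rho_set (range (translate x))))%:E
   = 1)%E.
Proof.
transitivity (\int[discrete_gaussian (range (translate x))]_w (1%:E : \bar R))%E.
  rewrite integral_lattice_gaussian//; apply: eq_esum => z _.
  by rewrite mul1r.
by rewrite integral_cst// mul1e; exact: probability_setT.
Qed.

Lemma lattice_gaussian_sqr_le x u (t : R) :
  (\int[discrete_gaussian (range (translate 0))]_w
     ((\sum_i u i 0 * w i 0) ^+ 2)%:E <=
   \int[discrete_gaussian (range (translate x))]_w
     ((\sum_i u i 0 * w i 0 - t) ^+ 2)%:E)%E.
Proof.
rewrite !integral_lattice_gaussian; [|by move=> w; exact: sqr_ge0..].
have := esum_lattice_gaussian 0; have := esum_lattice_gaussian x.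
have := rho_set_gt0 (rho_set_lattice_lty x) 0.
have := rho_set_gt0 (rho_set_lattice_lty 0) 0.
set r0 := fine (rho_set (range (translate 0))).
set r := fine (rho_set (range (translate x))).
move=> r0_gt0 r_gt0 sumx sum0.
(* A product of two values of [g] must carry both normalising constants, so each value carries the
   square root. *)
pose k := Num.sqrt ((r0 * r)^-1).
have kk : k * k = r0^-1 * r^-1.
  by rewrite -expr2 sqr_sqrtr -?invfM// invr_ge0 mulr_ge0// ltW.
pose al (w : 'cV[R]_n) := \sum_i u i 0 * w i 0.
have alD v w : al (v + w) = al v + al w.
  by rewrite -big_split/=; apply: eq_bigr => i _; rewrite mxE mulrDr.
have alN v : al (- v) = - al v.
  by rewrite -sumrN/=; apply: eq_bigr => i _; rewrite mxE mulrN.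
(* The affine form is halved because [p + q] and [p - q] are twice the points of the coset and of
   the lattice that are indexed by [y] and [z]. *)
pose f z := (al (lattice_vec b z + x) - t) / 2.
pose g z := expR (- (pi * (\sum_i (lattice_vec b z + x) i 0 ^+ 2) / 2)) * k.
have fE y z : f (y + z) + f (y - z) = al (lattice_vec b y + x) - t.
  by rewrite /f lattice_vecD lattice_vecB !alD alN; field.
have fB y z : f (y + z) - f (y - z) = al (lattice_vec b z + 0).
  by rewrite /f lattice_vecD lattice_vecB addr0 !alD alN; field.
(* parallelogram law *)
have gE y z : g (y + z) * g (y - z) =
    rho (lattice_vec b y + x) / r * (rho (lattice_vec b z + 0) / r0).
  rewrite /g mulrACA kk -expRD !rhoE mulrACA -expRD [r^-1 * _]mulrC.
  congr (expR _ * _); rewrite -!opprD -mulrDl -!mulrDr addr0 -mulrA.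
  congr (- (_ * _)); rewrite -!big_split/= mulr_suml.
  apply: eq_bigr => i _; rewrite lattice_vecD lattice_vecB !mxE.
  by field.
have rho_ge0 (w : 'cV[R]_n) : 0 <= rho w by exact: expR_ge0.
have p0 (w : 'cV[R]_n) : 0 <= rho w / r0 by apply: divr_ge0 => //; exact: ltW.
have px (w : 'cV[R]_n) : 0 <= rho w / r by apply: divr_ge0 => //; exact: ltW.
(* The lattice sum is spread over pairs by the total mass 1 of the coset law; for the right-hand
   side the two laws exchange roles. *)
rewrite (_ : (\esum_(z in _) _)%E =
  \esum_(h in [set: {ffun 'I_n -> int} * {ffun 'I_n -> int}])
     ((f (h.1 + h.2) - f (h.1 - h.2)) ^+ 2 *
       (g (h.1 + h.2) * g (h.1 - h.2)))%:E)%E; last first.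
  rewrite -(esum_pairr (T1 := {ffun 'I_n -> int}) _ _ sumx)//; last first.
    by move=> z; rewrite mulr_ge0 ?sqr_ge0.
  by apply: eq_esum => -[y z] _ /=; rewrite gE fB -/(al _); congr EFin; ring.
rewrite [leRHS](_ : _ =
  \esum_(h in [set: {ffun 'I_n -> int} * {ffun 'I_n -> int}])
     ((f (h.1 + h.2) + f (h.1 - h.2)) ^+ 2 *
       (g (h.1 + h.2) * g (h.1 - h.2)))%:E)%E; last first.
  rewrite -(esum_pairl (T2 := {ffun 'I_n -> int}) _ _ sum0)//; last first.
    by move=> z; rewrite mulr_ge0 ?sqr_ge0.
  by apply: eq_esum => -[y z] _ /=; rewrite gE fE -/(al _); congr EFin; ring.
(* The change of variables [(y + z, y - z)] leads from all pairs to the pairs of equal parity. *)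
rewrite -(reindex_esum _ _ _
  (fun h => ((f h.1 - f h.2) ^+ 2 * (g h.1 * g h.2))%:E)
  (@sumdiff_bij n)).
rewrite -(reindex_esum _ _ _
  (fun h => ((f h.1 + f h.2) ^+ 2 * (g h.1 * g h.2))%:E)
  (@sumdiff_bij n)).
apply: esum_same_class_le => p.
by rewrite mulr_ge0 ?expR_ge0// sqrtr_ge0.
Qed.

End variance.

(** * First and second moments under a law with finite second moment *)

Section moments.
Variables (R : realType) (n : nat) (P : probability (discrete_cV R n) R).
Hypothesis P_lty :
  (\int[P]_w (1 + \sum_i (w : 'cV[R]_n) i 0 ^+ 2)%:E < +oo)%E.

Let m : 'cV[R]_n := mx_expectation P (fun w : 'cV[R]_n => w).
Let M : 'M[R]_n := mx_expectation P (fun w : 'cV[R]_n => w *m w^T).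

(** Domination by [P_lty]; measurability is automatic on [discrete_cV]. *)
Lemma integrable_quadratic (f : 'cV[R]_n -> R) :
  (forall w, `|f w| <= 1 + \sum_i w i 0 ^+ 2) ->
  P.-integrable setT (fun w => (f w)%:E).
Proof.
move=> fle; apply/integrableP; split; first exact: measurable_fun_discrete_cV.
apply: le_lt_trans P_lty; apply: ge0_le_integral => //;
  try exact: measurable_fun_discrete_cV.
by move=> w _; rewrite lee_fin; exact: fle.
Qed.

Lemma sqr_coord_le (w : 'cV[R]_n) i : w i 0 ^+ 2 <= \sum_j w j 0 ^+ 2.
Proof. by rewrite (bigD1 i)//= lerDl sumr_ge0// => j _; exact: sqr_ge0. Qed.

Lemma integrable_coord i : P.-integrable setT (fun w : 'cV[R]_n => (w i 0)%:E).
Proof.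
apply: integrable_quadratic => w; have := sqr_coord_le w i.
by rewrite -(real_normK (num_real (w i 0))); nra.
Qed.

Lemma integrable_coordM i j :
  P.-integrable setT (fun w : 'cV[R]_n => (w i 0 * w j 0)%:E).
Proof.
apply: integrable_quadratic => w.
have := sqr_coord_le w i; have := sqr_coord_le w j.
rewrite normrM -(real_normK (num_real (w i 0))).
by rewrite -(real_normK (num_real (w j 0))); nra.
Qed.

(** Integrability makes the integral finite, so the [fine] in [mx_expectation] loses nothing. *)
Lemma mx_expectation_coord i :
  (\int[P]_w ((w : 'cV[R]_n) i 0)%:E = (m i 0)%:E)%E.
Proof.
rewrite mxE unlock fineK//.
exact: (integrable_fin_num measurableT (integrable_coord i)).
Qed.

Lemma mx_expectation_coordM i j :
  (\int[P]_w ((w : 'cV[R]_n) i 0 * (w : 'cV[R]_n) j 0)%:E = (M i j)%:E)%E.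
Proof.
rewrite mxE unlock; under [in RHS]eq_integral do rewrite !mxE big_ord1 mxE.
rewrite fineK//.
exact: (integrable_fin_num measurableT (integrable_coordM i j)).
Qed.

Lemma integral_sqr_l2norm :
  (\int[P]_w (l2norm (w : 'cV[R]_n) ^+ 2)%:E = (\sum_i M i i)%:E)%E.
Proof.
under eq_integral do rewrite l2norm_sqr -sumEFin.
rewrite integral_sum//; last by move=> i; exact: (integrable_coordM i i).
rewrite -sumEFin; apply: eq_bigr => i _.
exact: mx_expectation_coordM.
Qed.

Lemma integral_sqr_affine (u : 'cV[R]_n) (t : R) :
  (\int[P]_w ((\sum_i u i 0 * (w : 'cV[R]_n) i 0 - t) ^+ 2)%:E =
   (\sum_i \sum_j u i 0 * u j 0 * M i j
      - 2 * t * (\sum_i u i 0 * m i 0) + t ^+ 2)%:E)%E.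
Proof.
(* Quadratic and linear terms of the expanded square, with the scalars in front so that the integral
   can be taken term by term. *)
pose F i j (w : discrete_cV R n) :=
  ((u i 0 * u j 0)%:E * ((w : 'cV[R]_n) i 0 * (w : 'cV[R]_n) j 0)%:E)%E.
pose G i (w : discrete_cV R n) :=
  ((- (2 * t) * u i 0)%:E * ((w : 'cV[R]_n) i 0)%:E)%E.
have iF i j : P.-integrable setT (F i j).
  by apply: integrableZl => //; exact: integrable_coordM.
have iG i : P.-integrable setT (G i).
  by apply: integrableZl => //; exact: integrable_coord.
transitivity (\int[P]_w (\sum_i \sum_j F i j w + \sum_i G i w + (t ^+ 2)%:E))%E.
  apply: eq_integral => w _; rewrite /F /G.
  under [in RHS]eq_bigr do (under eq_bigr do rewrite -EFinM; rewrite sumEFin).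
  under [X in (_ + X + _)%E]eq_bigr do rewrite -EFinM.
  rewrite !sumEFin -!EFinD; congr EFin; rewrite sqrrB expr2 mulr_suml.
  congr (_ + _ + _).
    by apply: eq_bigr => i _; rewrite mulr_sumr; apply: eq_bigr => j _; ring.
  transitivity (- (2 * t) * \sum_i u i 0 * (w : 'cV[R]_n) i 0); first by ring.
  by rewrite mulr_sumr; apply: eq_bigr => i _; ring.
have iFs : P.-integrable setT (fun w => \sum_i \sum_j F i j w)%E.
  by apply: integrable_sum => // i _; exact: integrable_sum.
have iGs : P.-integrable setT (fun w => \sum_i G i w)%E.
  exact: integrable_sum.
rewrite integralD//; first last.
- exact: finite_measure_integrable_cst.
- exact: integrableD.
have t2E : (\int[P]_w (t ^+ 2)%:E = (t ^+ 2)%:E)%E.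
  rewrite integral_cst// -[RHS]mule1; congr (_ * _)%E.
  exact: probability_setT.
rewrite integralD// t2E.
rewrite !integral_sum//; last by move=> i; exact: integrable_sum.
under eq_bigr do rewrite integral_sum//.
rewrite !EFinD; congr (_ + _ + _)%E.
  rewrite -sumEFin; apply: eq_bigr => i _; rewrite -sumEFin.
  apply: eq_bigr => j _; rewrite /F integralZl//; last exact: integrable_coordM.
  by rewrite mx_expectation_coordM.
rewrite -mulNr mulr_sumr -sumEFin; apply: eq_bigr => i _.
rewrite /G integralZl//; last exact: integrable_coord.
by rewrite mx_expectation_coord -EFinM mulrA.
Qed.

End moments.

(** * The variance inequality for lattice cosets, from quadratic forms to matrices *)

Lemma lattice_gaussian_moment_lty (R : realType) (n : nat)
    (b : n.-tuple 'cV[R]_n) (x : 'cV[R]_n) : free b ->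
  (\int[discrete_gaussian (coset (range (lattice_vec b)) x)]_w
     (1 + \sum_i (w : 'cV[R]_n) i 0 ^+ 2)%:E < +oo)%E.
Proof.
move=> free_b; rewrite coset_lattice_vec.
have q0 (w : 'cV[R]_n) : 0 <= 1 + \sum_i w i 0 ^+ 2.
  by rewrite addr_ge0// sumr_ge0// => i _; exact: sqr_ge0.
rewrite (integral_lattice_gaussian free_b x q0).
have r_gt0 := rho_set_gt0 (rho_set_lattice_lty free_b x) 0.
under eq_esum do rewrite mulrA [X in X%:E]mulrC EFinM.
rewrite esumZl; last 2 first.
- by rewrite invr_ge0 ltW.
- by move=> z; rewrite lee_fin mulr_ge0 ?q0 ?expR_ge0.
rewrite lte_mul_pinfty ?lee_fin ?invr_ge0 ?(ltW r_gt0)//.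
exact: lattice_tail_lty.
Qed.

(** With [t] the mean of the linear form under [P x], the terms [- 2 * t * t + t ^+ 2] collapse to
    [- t ^+ 2]. *)
Lemma lattice_gaussian_variance (R : realType) (n : nat)
    (b : n.-tuple 'cV[R]_n) (x u : 'cV[R]_n)
    (P := fun y => discrete_gaussian (coset (range (lattice_vec b)) y)) :
  free b ->
  \sum_i \sum_j u i 0 * u j 0 *
      mx_expectation (P 0) (fun w : 'cV[R]_n => w *m w^T) i j <=
  \sum_i \sum_j u i 0 * u j 0 *
      mx_expectation (P x) (fun w : 'cV[R]_n => w *m w^T) i j -
    (\sum_i u i 0 * mx_expectation (P x) (fun w : 'cV[R]_n => w) i 0) ^+ 2.
Proof.
move=> free_b; set t := \sum_i u i 0 * _.
have := lattice_gaussian_sqr_le free_b x u t.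
(* Subtracting 0 puts the lattice side in the form of [integral_sqr_affine] with shift 0. *)
under eq_integral do rewrite -[X in X ^+ 2]subr0.
rewrite -!coset_lattice_vec -/(P x) -/(P 0).
rewrite (integral_sqr_affine (lattice_gaussian_moment_lty x free_b)).
rewrite (integral_sqr_affine (lattice_gaussian_moment_lty 0 free_b)).
rewrite lee_fin -/(P x) -/(P 0) -/t.
set M0 := \sum_i _; set M := \sum_i _.
nra.
Qed.

Theorem corollary3p2 (R : realType) (n : nat) (L : set 'cV[R]_n)
    (x : 'cV[R]_n) (hL : is_lattice L) :
  psd_ge
    (mx_expectation (discrete_gaussian (coset L x))
       (fun w : 'cV[R]_n => w *m w^T)
     - mx_expectation (discrete_gaussian (coset L x)) (fun w : 'cV[R]_n => w)
       *m mx_expectation (discrete_gaussian (coset L x))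
            (fun w : 'cV[R]_n => w^T))
    (mx_expectation (discrete_gaussian L) (fun w : 'cV[R]_n => w *m w^T))
  /\
  ('E_(discrete_gaussian L)[fun w : 'cV[R]_n => (l2norm w ^+ 2)%R] <=
   'E_(discrete_gaussian (coset L x))[fun w : 'cV[R]_n => (l2norm w ^+ 2)%R]
   - (l2norm (mx_expectation (discrete_gaussian (coset L x))
                (fun w : 'cV[R]_n => w)) ^+ 2)%:E)%E.
Proof.
case: hL => b [free_b ->]; rewrite -range_lattice_vec.
have var u := lattice_gaussian_variance x u free_b.
have P_lty := lattice_gaussian_moment_lty x free_b.
have P0_lty := lattice_gaussian_moment_lty 0 free_b.
have L0 : coset (range (lattice_vec b)) 0 = range (lattice_vec b).
  rewrite coset_lattice_vec; congr (_ @` _).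
  by apply/funext => z; rewrite addr0.
rewrite L0 in P0_lty.
rewrite L0 /= in var.
move: P_lty P0_lty var.
set P := discrete_gaussian (coset _ x); set P0 := discrete_gaussian (range _).
move=> P_lty P0_lty.
set M := mx_expectation P _; set M0 := mx_expectation P0 _.
set m := mx_expectation P _ => var.
have -> : mx_expectation P (fun w : 'cV[R]_n => w^T) = m^T.
  by apply/matrixP => i j; rewrite !mxE; congr (fine 'E_P[_]);
    apply/funext => w; rewrite mxE.
have symE (Q : probability (discrete_cV R n) R) :
    (mx_expectation Q (fun w : 'cV[R]_n => w *m w^T))^T =
    mx_expectation Q (fun w : 'cV[R]_n => w *m w^T).
  apply/matrixP => i j; rewrite !mxE; congr (fine 'E_Q[_]); apply/funext => w.
  by rewrite !mxE; apply: eq_bigr => k _; rewrite !mxE mulrC.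
have quadE (A : 'M[R]_n) v :
    (v^T *m A *m v) 0 0 = \sum_i \sum_j v i 0 * v j 0 * A i j.
  rewrite mxE exchange_big/=; apply: eq_bigr => j _; rewrite mxE mulr_suml.
  by apply: eq_bigr => i _; rewrite mxE; ring.
split.
  split.
    (* Symmetric means hermitian with sign exponent 0 and the identity as conjugation. *)
    apply/is_hermitianmxP; rewrite expr0 scale1r map_mx_id//.
    by rewrite !linearB/= trmx_mul trmxK !symE.
  move=> v; rewrite quadE.
  have -> : \sum_i \sum_j v i 0 * v j 0 * (M - m *m m^T - M0) i j =
      \sum_i \sum_j v i 0 * v j 0 * M i j - (\sum_i v i 0 * m i 0) ^+ 2 -
      \sum_i \sum_j v i 0 * v j 0 * M0 i j.
    rewrite expr2 mulr_suml -!sumrB; apply: eq_bigr => i _.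
    rewrite mulr_sumr -!sumrB; apply: eq_bigr => j _.
    by rewrite !mxE big_ord1 !mxE; ring.
  by rewrite subr_ge0; exact: var.
(* Both expected squared norms are traces of second-moment matrices. They are compared one diagonal
   entry at a time, by [var] at the standard basis vectors. *)
rewrite unlock (integral_sqr_l2norm P_lty) (integral_sqr_l2norm P0_lty).
rewrite -EFinB lee_fin l2norm_sqr -sumrB; apply: ler_sum => i _.
have := var (delta_mx i 0).
rewrite -!quadE trmx_delta -!rowE -!colE (bigD1 i)//= big1 => [|j ji].
  by rewrite !mxE !eqxx mul1r addr0 => ?; lra.
by rewrite mxE (negPf ji) mul0r.
Qed.
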